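(* Suppose $\alpha\ge1$ and $\alpha>e^{\alpha-2}$ (equivalently, $1\le\alpha<\alpha_\infty$, where $\alpha_\infty\approx3.146$ is the root in $[3,4]$ of $a=e^{a-2}$). Then there exists a positive integer $k$ such that no deterministic strictly monotone online algorithm for maximizing a non-negative monotone submodular function under a $k$-uniform matroid constraint with free disposal has competitive ratio $\frac1\alpha$.
   Context: Online problem with free disposal ($k$-uniform matroid): $\Omega$ is a ground set and $f:2^\Omega\to\mathbb{R}_+$ is submodular and monotone ($S\subseteq T$ implies $f(S)\le f(T)$). Distinct elements of $\Omega$ arrive one by one in a finite sequence whose length is unknown to the algorithm. The algorithm maintains a set $S$, initially empty, with $|S|\le k$. In each round, when $u$ arrives, it may remove elements from $S$ and may include $u$ in $S$, provided $|S|\le k$ afterwards; rejected or removed elements cannot be retrieved. The algorithm knows $k$ and has value oracle access to $f$ only on sets of elements that have arrived so far, so the decisions of a deterministic algorithm are determined by this information. $\mathsf{OPT}$ is a subset of at most $k$ elements of the sequence maximizing $f$. A deterministic algorithm has competitive ratio $r$ if for every instance and at the end of every finite sequence, $f(S)\ge r\cdot f(\mathsf{OPT})$. Strict monotonicity: an algorithm is strictly monotone if, in each round, it includes the new arriving element into $S$ (possibly removing some elements from $S$) only if the objective value $f(S)$ strictly increases compared to its value at the beginning of the round. *)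

(* Defs.v *)
From HB Require Import structures.
From mathcomp Require Import all_boot all_order all_algebra.
From mathcomp Require Import reals.

Set Implicit Arguments.
Unset Strict Implicit.
Unset Printing Implicit Defensive.

Import Order.TTheory GRing.Theory Num.Theory.
Local Open Scope ring_scope.

Section SetFunctions.
Variables (R : realType) (Omega : finType).
Implicit Types (f : {set Omega} -> R) (A B : {set Omega}).

Definition set_nonneg f : Prop := forall A, 0 <= f A.

Definition set_monotone f : Prop := forall A B, A \subset B -> f A <= f B.

Definition submodular f : Prop :=
  forall A B, f (A :|: B) + f (A :&: B) <= f A + f B.

Definition objective f : Prop :=
  [/\ set_nonneg f, set_monotone f & submodular f].

(* The elements of s, numbered by order of arrival. *)
Definition arrived (s : seq Omega) (I : {set 'I_(size s)}) : {set Omega} :=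
  [set tnth (in_tuple s) i | i in I].

Definition oracle f (s : seq Omega) : {set 'I_(size s)} -> R :=
  fun I => f (arrived I).

(* An optimal offline solution; the choice among maximizers is immaterial. *)
Definition OPT (k : nat) f (s : seq Omega) : {set Omega} :=
  [arg max_(O > set0 | (O \subset s) && (#|O| <= k)%N) f O]%O.

End SetFunctions.

(* A deterministic online algorithm: after n arrivals it has access to the     *)
(* values of f on the sets of arrived elements, which are designated by their  *)
(* arrival index, and it returns the set S that it holds at the end of round n.*)
(* The values available in earlier rounds, hence the earlier decisions, can be *)
(* recovered from this data. Neither the ground set nor the length of the      *)
(* sequence is an input.                                                       *)
Definition algorithm (R : realType) : Type :=
  forall n : nat, ({set 'I_n} -> R) -> {set 'I_n}.

Section Online.
Variables (R : realType) (k : nat) (alg : algorithm R).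

Definition held (Omega : finType) (f : {set Omega} -> R) (s : seq Omega) :
    {set Omega} :=
  arrived (alg (oracle f (s := s))).

(* No element enters S except u in the round of its arrival, so that rejected  *)
(* or removed elements are never retrieved; S is empty before the first round  *)
(* because 'I_0 is empty.                                                      *)
Definition free_disposal : Prop :=
  forall (Omega : finType) (f : {set Omega} -> R) (s : seq Omega) (u : Omega),
    objective f -> uniq (rcons s u) ->
    held f (rcons s u) \subset u |: held f s /\
    (#|held f (rcons s u)| <= k)%N.

Definition strictly_monotone : Prop :=
  forall (Omega : finType) (f : {set Omega} -> R) (s : seq Omega) (u : Omega),
    objective f -> uniq (rcons s u) ->
    u \in held f (rcons s u) -> f (held f s) < f (held f (rcons s u)).

Definition competitive_ratio (r : R) : Prop :=
  forall (Omega : finType) (f : {set Omega} -> R) (s : seq Omega),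
    objective f -> uniq s -> r * f (OPT k f s) <= f (held f s).

End Online.

(* Main.v *)
(* The objective is a weighted coverage function, and its elements are all the
   sets of points (p, i) of weight w p, where w is nondecreasing. In phase p the
   adversary sends singletons {(p, i)} until the algorithm holds m of them, and
   then sends the union B_p of these m singletons as a single element. The
   marginal value of B_p is 0, so a strictly monotone algorithm rejects it,
   whereas the offline solution collects the whole past of the algorithm with
   the few elements B_p. With k = n m, and while the current singletons are not
   accepted, the offline solution is worth almost
   m (sum_(q < p) w q + n w p), and what the algorithm holds is worth at most
   m sum_(p - n < q <= p) w q. In the limit, with F the primitive of w, the
   acceptance is forced if F' > (alpha - 1) F - alpha F(t - 1). For F(t) = t^n,
   whose logarithmic derivative lambda decreases slowly from infinity to 0, this
   amounts to lambda + alpha e^(- lambda) > alpha - 1 for all lambda, that is to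
   2 + ln alpha > alpha. Once lambda is close to 0, even a full set of maximal
   weights is not competitive with the union of the past phases. *)
Require Import Defs.
From HB Require Import structures.
From mathcomp Require Import all_boot all_order all_algebra.
From mathcomp Require Import all_classical all_reals all_analysis.
From mathcomp Require Import fintype finset ring lra.

Import Order.TTheory GRing.Theory Num.Theory.
Local Open Scope ring_scope.

(** * Binomial and exponential estimates, and the choice of weights *)

Lemma sum_bin_diag (e p : nat) :
  (\sum_(0 <= q < p) 'C(q + e, e) = 'C(p + e, e.+1))%N.
Proof.
elim: p => [|p IHp]; first by rewrite big_geq // bin_small.
by rewrite big_nat_recr //= IHp addSn binS.
Qed.

(** The quotient of the two binomials is the product of [(a + i) / (b + i)] over [i < j], and each
    factor is at least [a / b]. *)
Lemma leq_exp_bin_diag (a b j : nat) : (a <= b)%N ->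
  (a ^ j * 'C((b + j).-1, j) <= b ^ j * 'C((a + j).-1, j))%N.
Proof.
move=> le_ab; elim: j => [|j IHj]; first by rewrite !bin0.
rewrite !addnS /= -(leq_pmul2l (ltn0Sn j)) mulnCA [leqRHS]mulnCA.
rewrite -!mul_bin_diag !expnS.
have le2 : (a * (b + j) <= b * (a + j))%N.
  by rewrite !mulnDr [(b * a)%N]mulnC leq_add2l leq_mul2r le_ab orbT.
have := leq_mul le2 IHj.
by rewrite -!mulnA ![((_ + j) * (_ ^ _ * _))%N]mulnCA.
Qed.

(** From [1 + t <= expR t] follows [expR (- t) * (1 - t ^+ 2) <= 1 - t]; take the [j]-th power and
    apply Bernoulli's inequality to [1 - t ^+ 2]. *)
Lemma expR_le_exp1B {R : realType} (t : R) (j : nat) : 0 <= t <= 1 ->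
  expR (- (j%:R * t)) * (1 - j%:R * t ^+ 2) <= (1 - t) ^+ j.
Proof.
move=> /andP[t0 t1].
have t2 : t ^+ 2 <= 1 by rewrite expr_le1.
have bernoulli : 1 - j%:R * t ^+ 2 <= (1 - t ^+ 2) ^+ j.
  have u0 : 0 <= t ^+ 2 by rewrite exprn_ge0.
  move: (t ^+ 2) u0 t2 => u u0 u1.
  elim: j => [|j IHj]; first by rewrite mul0r subr0.
  have ju : 0 <= j%:R * u ^+ 2 by rewrite mulr_ge0 ?exprn_ge0.
  have : (1 - u) * (1 - j%:R * u) <= (1 - u) ^+ j.+1.
    by rewrite exprS ler_wpM2l ?subr_ge0.
  by apply: le_trans; rewrite -natr1; move: ju; rewrite expr2; nra.
have le1 : expR (- t) * (1 - t ^+ 2) <= 1 - t.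
  have -> : 1 - t = (expR (- t) * expR t) * (1 - t).
    by rewrite -expRD addNr expR0 mul1r.
  have -> : 1 - t ^+ 2 = (1 + t) * (1 - t) by ring.
  rewrite -mulrA ler_wpM2l ?expR_ge0 // ler_wpM2r ?subr_ge0 //.
  exact: expR_ge1Dx.
apply: (@le_trans _ _ ((expR (- t) * (1 - t ^+ 2)) ^+ j)).
  by rewrite exprMn -expRM_natl mulrN ler_wpM2l ?expR_ge0.
by rewrite lerXn2r ?nnegrE ?subr_ge0 // mulr_ge0 ?expR_ge0 ?subr_ge0.
Qed.

(* [gamma] pays for the elements B_p, whose number does not grow with m. *)
Lemma weight_gap {R : realType} (alpha : R) :
    1 <= alpha -> expR (alpha - 2) < alpha ->
  exists (e : nat) (gamma : R), 0 < gamma /\ forall p : nat,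
    alpha * \sum_(p.+1 - e.+1 <= q < p.+1) 'C(q + e, e)%:R
      + gamma * 'C(p + e, e)%:R
    <= \sum_(0 <= q < p) 'C(q + e, e)%:R + e.+1%:R * 'C(p + e, e)%:R.
Proof.
move=> alpha1 alpha_gt; have alpha0 : 0 < alpha by lra.
(* The slack in the hypothesis: one half absorbs the errors of order [1 / n], the other half is
   [gamma]. *)
pose kappa := 2 + ln alpha - alpha.
have kappa0 : 0 < kappa.
  have : ln (expR (alpha - 2)) < ln alpha by rewrite ltr_ln ?posrE ?expR_gt0.
  by rewrite expRK /kappa; lra.
have kappa2 : kappa < 2 by have := ln_sublinear alpha0; rewrite /kappa; lra.
(* [c / n] bounds the errors of [exp_ge] and [w_ge] together, once [mu < 2 * alpha]. *)
pose c := 4 * alpha ^+ 3 + 4 * alpha ^+ 2 + 2 * alpha.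
have c0 : 0 < c by rewrite !addr_gt0 ?mulr_gt0 ?exprn_gt0.
pose e := Num.trunc (2 * (1 + alpha) + 2 * c / kappa).
have := truncnS_gt (2 * (1 + alpha) + 2 * c / kappa); rewrite -/e => e_gt.
have ck0 : 0 < 2 * c / kappa by rewrite divr_gt0 // mulr_gt0.
have n_gt : 2 * (1 + alpha) < e.+1%:R by lra.
have n_kappa : c / e.+1%:R <= kappa / 2.
  have : 2 * c / kappa < e.+1%:R by lra.
  rewrite ltr_pdivrMr // => ?; rewrite ler_pdivrMr ?ltr0Sn //; lra.
exists e, (kappa / 2); split=> [|p]; first by rewrite divr_gt0.
pose V q : R := 'C(q + e, e.+1)%:R.
have sumV q : \sum_(0 <= i < q) 'C(i + e, e)%:R = V q.
  by rewrite /V -sum_bin_diag natr_sum.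
have sumV2 : \sum_(p.+1 - e.+1 <= q < p.+1) 'C(q + e, e)%:R
    = V p.+1 - V (p.+1 - e.+1)%N.
  by rewrite -!sumV (big_cat_nat (leq0n _) (leq_subr e.+1 p.+1)) /= addrC addrK.
have VS : V p.+1 = V p + 'C(p + e, e)%:R by rewrite -!sumV big_nat_recr.
have w0 : 0 < 'C(p + e, e)%:R :> R by rewrite ltr0n bin_gt0 leq_addl.
have wV : e.+1%:R * V p.+1 = (p%:R + e.+1%:R) * 'C(p + e, e)%:R.
  by rewrite /V -natrD -!natrM addnS mul_bin_diag -addSn.
have V0 q : 0 <= V q by [].
rewrite sumV2 sumV.
move: ('C(p + e, e)%:R) VS w0 wV => w VS w0 wV.
have n0 : 0 < e.+1%:R :> R by [].
have p0 : 0 <= p%:R :> R by [].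
have WV : w <= V p.+1 by rewrite VS lerDr V0.
(* With n = e.+1, mu = n^2 / (p + 1) and W p the sum of the weights up to p, the
   ratios w p / W p and W (p - n) / W p are close to mu / n and e^(- mu). *)
have [small|large] := leP (2 * alpha * (p%:R + 1)) (e.+1%:R ^+ 2).
  have alphaV : alpha * V p.+1 <= (e.+1%:R - 1) * w.
    rewrite -(ler_pM2l n0) mulrCA wV; move: small n_gt alpha0 p0 w0.
    move: (e.+1%:R : R) (p%:R : R) => n x small n_gt alpha0 x0 w0.
    rewrite !mulrA ler_pM2r //; nra.
  have := V0 (p.+1 - e.+1)%N; nra.
have [mu muE] : exists mu, mu = e.+1%:R * (e.+1%:R / p.+1%:R) :> R.
  by eexists.
have M0 : 0 < p.+1%:R :> R by [].
have ME : p.+1%:R = p%:R + 1 :> R by rewrite -natr1.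
have muM : mu * p.+1%:R = e.+1%:R ^+ 2.
  by rewrite muE mulrA mulfVK ?expr2 ?gt_eqF.
have mu0 : 0 < mu by rewrite muE !mulr_gt0 ?invr_gt0.
have mu2 : mu < 2 * alpha by rewrite -(ltr_pM2r M0) muM ME.
have le_np : (e.+1 <= p.+1)%N.
  rewrite -(ler_nat R) -(ler_pM2l (mulr_gt0 (ltr0n _ 2) alpha0)) ME.
  by apply: le_trans (ltW large); rewrite expr2 ler_pM2r //; lra.
have t01 : 0 <= (e.+1%:R / p.+1%:R : R) <= 1.
  by rewrite divr_ge0 //= ler_pdivrMr // mul1r ler_nat.
have V_ge : (1 - e.+1%:R / p.+1%:R) ^+ e.+1 * V p.+1 <= V (p.+1 - e.+1)%N.
  have -> : 1 - e.+1%:R / p.+1%:R = (p.+1 - e.+1)%:R / p.+1%:R :> R.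
    by rewrite natrB // mulrBl divff ?gt_eqF.
  rewrite expr_div_n mulrAC ler_pdivrMr ?exprn_gt0 //.
  rewrite [leRHS]mulrC -!natrX -!natrM ler_nat.
  by have := leq_exp_bin_diag _ _ e.+1 (leq_subr e.+1 p.+1); rewrite !addnS.
have exp_ge : 1 + ln alpha - mu - 4 * alpha ^+ 3 / e.+1%:R
    <= alpha * (1 - e.+1%:R / p.+1%:R) ^+ e.+1.
  have := expR_le_exp1B _ e.+1 t01; rewrite -muE => exp_le.
  apply: le_trans (ler_wpM2l (ltW alpha0) exp_le).
  have -> : e.+1%:R * (e.+1%:R / p.+1%:R) ^+ 2 = mu ^+ 2 / e.+1%:R :> R.
    by rewrite muE; field; rewrite !nat1r !pnatr_eq0.
  (* Tangent line of the exponential at 0, taken at [ln alpha - mu]. *)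
  have : 1 + ln alpha - mu <= alpha * expR (- mu).
    rewrite -{2}(lnK alpha0) -expRD -addrA; exact: expR_ge1Dx.
  have E1 : expR (- mu) <= 1 by rewrite -expR0 ler_expR oppr_le0 ltW.
  have E0 : 0 <= alpha * expR (- mu) by rewrite mulr_ge0 ?expR_ge0 ?ltW.
  have d0 : 0 <= mu ^+ 2 / e.+1%:R by rewrite divr_ge0 ?sqr_ge0.
  have d_le : alpha * (mu ^+ 2 / e.+1%:R) <= 4 * alpha ^+ 3 / e.+1%:R.
    have -> : 4 * alpha ^+ 3 = alpha * (2 * alpha) ^+ 2 by ring.
    rewrite mulrA ler_pM2r ?invr_gt0 // ler_pM2l //.
    by rewrite ler_sqr ?nnegrE ltW // mulr_gt0.
  have : alpha * expR (- mu) * (mu ^+ 2 / e.+1%:R)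
      <= alpha * (mu ^+ 2 / e.+1%:R).
    by rewrite ler_wpM2r // ler_piMr ?(ltW alpha0).
  move: (mu ^+ 2 / _) (4 * _ / _) d_le => d b.
  by rewrite mulrBr mulr1 !mulrBr mulrA; clear; lra.
have w_ge : (mu - (mu ^+ 2 + mu) / e.+1%:R) * V p.+1 <= (e.+1%:R - 1) * w.
  rewrite -(ler_pM2l n0) mulrCA wV !mulrA ler_pM2r //.
  rewrite -(ler_pM2r n0) -(ler_pM2r M0).
  have -> : (mu - (mu ^+ 2 + mu) / e.+1%:R) * (p%:R + e.+1%:R) * e.+1%:R
      * p.+1%:R = (mu * p.+1%:R) * (e.+1%:R - 1 - mu) * (p%:R + e.+1%:R).
    by field; rewrite nat1r pnatr_eq0.
  have -> : e.+1%:R * (e.+1%:R - 1) * e.+1%:R * p.+1%:R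
      = e.+1%:R ^+ 2 * ((e.+1%:R - 1) * p.+1%:R) :> R by ring.
  rewrite muM -[leLHS]mulrA ler_pM2l ?exprn_gt0 // ME.
  move: muM; rewrite ME expr2; move: (ltW mu0) p0.
  have : 1 <= e.+1%:R :> R by rewrite ler1n.
  by move: (e.+1%:R : R) (p%:R : R) => n x; clear; nra.
(* Adding these bounds cancels [mu] and leaves at least [(alpha - 1 + kappa / 2) * W p]; the surplus
   pays for [gamma * w] because [w <= W p]. *)
move: w_ge (ler_wpM2r (V0 p.+1) exp_ge) (ler_wpM2l (ltW alpha0) V_ge).
have n_le : (mu ^+ 2 + mu) / e.+1%:R + 4 * alpha ^+ 3 / e.+1%:R <= kappa / 2.
  apply: le_trans n_kappa; rewrite -mulrDl ler_pM2r ?invr_gt0 // /c.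
  have : mu ^+ 2 <= (2 * alpha) ^+ 2 by rewrite ler_sqr ?nnegrE ltW // mulr_gt0.
  by move: mu2; rewrite exprMn; clear; lra.
move: n_le; rewrite [alpha * (_ * _)]mulrA.
move: ((mu ^+ 2 + mu) / _) (4 * _ / _) (alpha * _ ^+ _).
rewrite /kappa in kappa0 *; move: VS WV kappa0 w0.
move: (V p.+1) (V p) (V (p.+1 - e.+1)%N) (e.+1%:R : R) => W Vp Vm n.
move=> VS WV k0 w0' d1 d2 g d12 w_ge g_ge Vm_ge.
clear -VS WV k0 w0' d12 w_ge g_ge Vm_ge.
nra.
Qed.

(** * Sums of weights by level *)

Lemma sum_levels {R : nzRingType} {I : finType} (H : {set I}) (g : I -> nat)
    (F : nat -> R) (l u : nat) :
  \sum_(x in H) (if (l <= g x < u)%N then F (g x) else 0)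
    = \sum_(l <= q < u) #|[set x in H | g x == q]|%:R * F q.
Proof.
under eq_bigr => x _ do rewrite -(@big_nat1_eq R 0 +%R).
rewrite (exchange_big_dep xpredT) //=; apply: eq_bigr => q _.
rewrite (eq_bigl (mem [set x in H | g x == q])); last first.
  by move=> x; rewrite !inE eq_sym.
by rewrite sumr_const mulr_natl.
Qed.

(** A threshold [th] separates the weights below the window from those inside. Every member of [H]
    is charged [th], and the excess over [th] arises only inside the window, at most [m] times per
    level. *)
Lemma sum_le_window {R : realDomainType} {I : finType} (H : {set I})
    (g : I -> nat) (w : nat -> R) (n m p : nat) :
    (forall q, 0 <= w q) -> {homo w : a b / (a <= b)%N >-> a <= b} ->
    {in H, forall x, (g x <= p)%N} ->
    (forall q, (#|[set x in H | g x == q]| <= m)%N) -> (#|H| <= n * m)%N ->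
  \sum_(x in H) w (g x) <= m%:R * \sum_(p.+1 - n <= q < p.+1) w q.
Proof.
move=> w0 wh gp lev cardH; set l := (p.+1 - n)%N.
have [th [th0 thl thu thH]] : exists th, [/\ 0 <= th,
    forall q, (q < l)%N -> w q <= th, forall q, (l <= q)%N -> th <= w q
    & #|H|%:R * th <= m%:R * (p.+1 - l)%:R * th].
  have [lenp|ltpn] := leqP n p.+1.
    exists (w l); split=> // [q /ltnW /wh //|q /wh //|].
    by rewrite ler_wpM2r // -natrM ler_nat /l subKn // mulnC.
  (* Here the truncated subtraction gives [l = 0]: no level lies below the window. *)
  exists 0; split=> // [q|]; first by rewrite /l (eqP (ltnW ltpn : _ == _)).
  by rewrite !mulr0.
apply: (@le_trans _ _ (\sum_(x in H)
    (th + (if (l <= g x < p.+1)%N then w (g x) - th else 0)))).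
  apply: ler_sum => x /gp; rewrite ltnS => ->; rewrite andbT.
  by case: leqP => [_|/thl]; rewrite ?addr0 // addrC subrK.
rewrite big_split /= sumr_const -[th *+ _]mulr_natl.
rewrite (sum_levels H g (fun q => w q - th)).
have : \sum_(l <= q < p.+1) #|[set x in H | g x == q]|%:R * (w q - th)
    <= \sum_(l <= q < p.+1) m%:R * (w q - th).
  rewrite big_seq [leRHS]big_seq; apply: ler_sum => q.
  rewrite mem_index_iota => /andP[lq _].
  by rewrite ler_wpM2r ?ler_nat // subr_ge0 thu.
rewrite -mulr_sumr sumrB sumr_const_nat mulrBr -[th *+ (_ - _)]mulr_natl => le2.
by move: (lerD thH le2); rewrite mulrA addrCA subrr addr0.
Qed.

(** * Weighted coverage functions *)

Definition coverage {R : realType} {T : finType} (w : T -> R)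
  (A : {set {set T}}) : R := \sum_(t in cover A) w t.

Lemma coverU {T : finType} (A B : {set {set T}}) :
  cover (A :|: B) = cover A :|: cover B.
Proof. exact: bigcup_setU. Qed.

Lemma le_sum_subset {R : realType} {T : finType} (w : T -> R) (A B : {set T}) :
  (forall t, 0 <= w t) -> A \subset B -> \sum_(t in A) w t <= \sum_(t in B) w t.
Proof.
move=> w0 /setIidPr AB; rewrite [leRHS](big_setID A) /= AB lerDl.
exact: sumr_ge0.
Qed.

(** Submodularity is inclusion-exclusion for the two covers, since the cover of an intersection lies
    in the intersection of the covers. *)
Lemma coverage_objective {R : realType} {T : finType} (w : T -> R) :
  (forall t, 0 <= w t) -> objective (coverage w).
Proof.
move=> w0; split=> [A|A B AB|A B].
- exact: sumr_ge0.
- by apply: le_sum_subset => //; rewrite -(setUidPr AB) coverU subsetUl.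
- rewrite /coverage coverU -lerBrDr.
  have -> : \sum_(t in cover A :|: cover B) w t
      = \sum_(t in cover A) w t + \sum_(t in cover B) w t
        - \sum_(t in cover A :&: cover B) w t.
    rewrite (big_setID (cover A)) setUK setDUl setDv set0U /= -addrA.
    congr (_ + _); rewrite [X in X - _](big_setID (cover A)) /=.
    by rewrite setIC [RHS]addrC addKr.
  rewrite lerB // le_sum_subset // subsetI.
  by apply/andP; split; apply/subsetP => t /bigcupP[C];
    rewrite inE => /andP[CA CB] tC; apply/bigcupP; exists C.
Qed.

(** * Held sets and comparison with arbitrary offline solutions *)

Lemma mem_held {R : realType} (alg : algorithm R) {Omega : finType}
    (f : {set Omega} -> R) (s : seq Omega) : {subset held alg f s <= s}.
Proof. by move=> x /imsetP[i _ ->]; rewrite (mem_tnth i (in_tuple s)). Qed.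

Lemma held_nil {R : realType} (alg : algorithm R) {Omega : finType}
    (f : {set Omega} -> R) : held alg f [::] = set0.
Proof.
by apply/setP => x; rewrite inE; apply/negbTE/negP => /mem_held.
Qed.

Lemma competitive_ratio_le {R : realType} (k : nat) (alg : algorithm R) (r : R)
    {Omega : finType} (f : {set Omega} -> R) (s : seq Omega) (O : {set Omega}) :
    competitive_ratio k alg r -> 0 <= r -> objective f -> uniq s ->
    {subset O <= s} -> (#|O| <= k)%N ->
  r * f O <= f (held alg f s).
Proof.
move=> cr r0 fo us Os Ok; apply: le_trans (cr _ f s fo us).
rewrite ler_wpM2l // /OPT; case: arg_maxP => [|X _]; last first.
  by apply; rewrite Ok andbT; apply/subsetP.
by rewrite cards0 andbT; apply/subsetP => x; rewrite inE.
Qed.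

(** * The adversary and its invariant *)

Section Adversary.
Set Implicit Arguments.
Unset Strict Implicit.
Variables (R : realType) (n m P N : nat) (w : nat -> R) (alpha : R).
Variable alg : algorithm R.
Hypotheses (w_ge0 : forall q, 0 <= w q)
  (w_homo : {homo w : a b / (a <= b)%N >-> a <= b}).
Hypotheses (m_gt1 : (1 < m)%N) (kE : (P + N = n * m)%N) (alpha_gt0 : 0 < alpha).
Hypotheses (alg_disposal : free_disposal (n * m) alg)
  (alg_monotone : strictly_monotone alg)
  (alg_ratio : competitive_ratio (n * m) alg alpha^-1).

Local Notation point := ('I_P * 'I_N)%type.
Implicit Types (s : seq {set point}) (t : point) (B C : {set point}).

Definition weight t : R := w t.1.
Local Notation f := (coverage weight).

Definition phase (q : nat) : {set point} := [set t : point | t.1 == q :> nat].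

Definition held_points s : {set point} :=
  [set t : point | [set t] \in held alg f s].

(* Phases 0, ..., p - 1 are completed, and i singletons of phase p were sent. *)
Record reached (p i : nat) s : Prop := Reached {
  reached_uniq : uniq s;
  reached_element : forall B, B \in s -> B != set0 /\ forall t, t \in B ->
    (t.1 < p)%N \/ [/\ t.1 = p :> nat, (t.2 < i)%N & #|B| = 1%N];
  reached_held : forall B, B \in held alg f s -> #|B| = 1%N;
  reached_phase : forall q : 'I_P, (q < p)%N ->
    exists B, [/\ B \in s, #|B| = m & B \subset phase q];
  reached_load : forall q, (#|held_points s :&: phase q| <= m)%N;
  reached_points : forall t, t.1 = p :> nat -> (t.2 < i)%N -> [set t] \in s }.

Lemma f_objective : objective f.
Proof. by apply: coverage_objective => t; apply: w_ge0. Qed.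

Lemma reached_held_lt p i s t : reached p i s -> t \in held_points s ->
  (t.1 < p)%N \/ t.1 = p :> nat /\ (t.2 < i)%N.
Proof.
move=> rs; rewrite inE => /mem_held /(reached_element rs)[_ /(_ t)].
by rewrite set11 => /(_ isT)[|[]]; [left|right].
Qed.

Lemma cover_held p i s : reached p i s -> cover (held alg f s) = held_points s.
Proof.
move=> rs; apply/setP => t; rewrite inE; apply/bigcupP/idP => [[B Bs tB]|ts].
  have /eqP/cards1P[x Bx] := reached_held rs Bs.
  by move: tB Bs; rewrite Bx inE => /eqP ->.
by exists [set t]; rewrite ?set11.
Qed.

Lemma card_held s : uniq s -> (#|held alg f s| <= n * m)%N.
Proof.
case/lastP: s => [_|s u us]; first by rewrite held_nil cards0.
by have [] := alg_disposal f_objective us.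
Qed.

Lemma held_value p i s : reached p i s ->
  f (held alg f s) <= m%:R * \sum_(p.+1 - n <= q < p.+1) w q.
Proof.
move=> rs; rewrite /coverage (cover_held rs).
apply: (@sum_le_window _ _ _ (fun t => t.1)) => //.
- by move=> t /(reached_held_lt rs)[/ltnW|[->]].
- move=> q; apply: leq_trans (reached_load rs q).
  by apply: subset_leq_card; apply/subsetP => t; rewrite !inE.
- apply: leq_trans (card_held (reached_uniq rs)).
  rewrite -(card_imset _ (@set1_inj _)); apply: subset_leq_card.
  by apply/subsetP => B /imsetP[t]; rewrite inE => ts ->.
Qed.

(** Only a bound, because the phase is empty when [q >= P]. *)
Lemma card_phase q : (#|phase q| <= N)%N.
Proof.
rewrite -[leqRHS](card_ord N) -(card_in_imset (f := snd) (D := phase q)).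
  exact: max_card.
move=> [a i] [b j]; rewrite !inE /= => /eqP qa /eqP qb ->.
by congr (_, _); apply: val_inj; rewrite /= qa qb.
Qed.

(** The offline solution takes an [m]-point element of each completed phase and all singletons of
    phase [p]; it fits because [P + N = n * m]. The case [p = P], with an empty last phase, serves
    for the end of the game. *)
Lemma reached_ratio p i s : (p <= P)%N -> reached p i s ->
    (forall t, t.1 = p :> nat -> [set t] \in s) ->
  m%:R * \sum_(0 <= q < p) w q + #|phase p|%:R * w p
    <= alpha * (m%:R * \sum_(p.+1 - n <= q < p.+1) w q).
Proof.
move=> pP rs ps; rewrite -ler_pdivrMl //.
have /fin_all_exists[b bP] : forall q : 'I_P, exists B, (q < p)%N ->
    [/\ B \in s, #|B| = m & B \subset phase q].
  move=> q; case: (ltnP q p) => [/(reached_phase rs)[B BP]|_].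
    by exists B.
  by exists set0.
pose O := [set b q | q in [pred q : 'I_P | (q < p)%N]]
  :|: [set [set t] | t in phase p].
have Os : {subset O <= s}.
  move=> B /setUP[/imsetP[q qp ->]|/imsetP[t tp ->]].
    by have [] := bP q qp.
  by apply: ps; move: tp; rewrite inE => /eqP.
have Ok : (#|O| <= n * m)%N.
  rewrite -kE; apply: leq_trans (leq_card_setU _ _) (leq_add _ _).
    by rewrite (leq_trans (leq_imset_card _ _)) // -[leqRHS]card_ord max_card.
  by rewrite (leq_trans (leq_imset_card _ _)) // card_phase.
apply: le_trans (held_value rs).
have alphaV0 : 0 <= alpha^-1 by rewrite invr_ge0 ltW.
have := competitive_ratio_le _ _ _ _ _ _ alg_ratio alphaV0 f_objective
  (reached_uniq rs) Os Ok.
apply: le_trans; rewrite ler_wpM2l // /coverage.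
have : \sum_(0 <= q < p.+1) #|[set t in cover O | t.1 == q :> nat]|%:R * w q
   <= \sum_(t in cover O) weight t.
  rewrite -(sum_levels (cover O) (fun t => t.1 : nat)); apply: ler_sum => t _.
  by case: ifP => // _; exact: w_ge0.
apply: le_trans; rewrite big_nat_recr //= mulr_sumr.
rewrite lerD //; last first.
  rewrite ler_wpM2r // ler_nat; apply: subset_leq_card; apply/subsetP => t tp.
  rewrite inE; apply/andP; split; last by move: tp; rewrite inE.
  apply/bigcupP; exists [set t]; rewrite ?set11 // inE; apply/orP; right.
  exact: imset_f.
rewrite big_seq [leRHS]big_seq; apply: ler_sum => q.
rewrite mem_index_iota => /andP[_ qp].
pose q' := Ordinal (leq_trans qp pP).
have [_ bm bq] := bP q' qp.
rewrite ler_wpM2r // ler_nat -bm; apply: subset_leq_card; apply/subsetP => t tb.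
rewrite inE; apply/andP; split; last first.
  by move/subsetP: bq => /(_ t tb); rewrite inE.
apply/bigcupP; exists (b q') => //; rewrite inE; apply/orP; left.
exact: imset_f.
Qed.

Lemma reached_send p s (x : point) : (x.1 = p :> nat) ->
    reached p x.2 s -> (#|held_points s :&: phase p| < m)%N ->
  reached p x.2.+1 (rcons s [set x]).
Proof.
move=> xp rs load.
have xs : [set x] \notin s.
  apply/negP => /(reached_element rs)[_ /(_ x)]; rewrite set11 => /(_ isT).
  by rewrite xp !ltnn => -[//|[]].
have us : uniq (rcons s [set x]) by rewrite rcons_uniq xs (reached_uniq rs).
have [/subsetP hsub _] := alg_disposal f_objective us.
split=> //.
- move=> B; rewrite mem_rcons inE => /orP[/eqP ->|/(reached_element rs)[B0 Bt]].
    split=> [|t]; first by apply/set0Pn; exists x; rewrite set11.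
    by rewrite inE => /eqP ->; right; rewrite cards1.
  by split=> // t /Bt[|[tp ti B1]]; [left|right; rewrite ltnS ltnW].
- by move=> B /hsub /setU1P[->|/(reached_held rs)//]; rewrite cards1.
- move=> q /(reached_phase rs)[B [Bs Bm Bq]].
  by exists B; rewrite mem_rcons inE Bs orbT.
- have hp : held_points (rcons s [set x]) \subset x |: held_points s.
    apply/subsetP => t; rewrite !inE => /hsub /setU1P[/set1_inj ->|->].
      by rewrite eqxx.
    by rewrite orbT.
  move=> q; have [->|qp] := eqVneq q p.
    apply: leq_trans load; rewrite -add1n.
    apply: leq_trans (subset_leq_card (setSI _ hp)) _.
    rewrite setIUl; apply: leq_trans (leq_card_setU _ _) (leq_add _ _) => //.
    by rewrite (leq_trans (subset_leq_card (subsetIl _ _))) // cards1.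
  apply: leq_trans (reached_load rs q); apply: subset_leq_card.
  apply/subsetP => t /setIP[/(subsetP hp)/setU1P[->|th] tq].
    by move: tq qp; rewrite inE xp => /eqP ->; rewrite eqxx.
  by rewrite inE th.
- move=> t tp; rewrite ltnS mem_rcons inE leq_eqVlt => /orP[/eqP tx|tx].
    rewrite (_ : t = x) ?eqxx //.
    case: t x tp tx xp {rs load xs us hsub} => [a c] [b d] /= ap cd bp.
    by congr (_, _); apply: val_inj; rewrite //= ap.
  by rewrite (reached_points rs) // orbT.
Qed.

Lemma reached_cover p i s : (p < P)%N -> reached p i s ->
    (m <= #|held_points s :&: phase p|)%N ->
  reached p.+1 0 (rcons s (held_points s :&: phase p)).
Proof.
move=> pP rs load; set C := held_points s :&: phase p.
have Cm : #|C| = m by apply/eqP; rewrite eqn_leq load (reached_load rs).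
have C0 : C != set0 by rewrite -card_gt0 Cm ltnW.
(* The sent elements that meet phase [p] are singletons, whereas [C] has [m > 1] points. *)
have Cs : C \notin s.
  have /set0Pn[t tC] := C0; apply/negP => /(reached_element rs)[_ /(_ t tC)].
  have : t.1 = p :> nat by case/setIP: tC => _; rewrite inE => /eqP.
  move=> ->; rewrite ltnn => -[//|[_ _]].
  by rewrite Cm => m1; move: m_gt1; rewrite m1.
have us : uniq (rcons s C) by rewrite rcons_uniq Cs (reached_uniq rs).
have [hsub _] := alg_disposal f_objective us.
have CH : C \notin held alg f (rcons s C).
  apply/negP => /(alg_monotone f_objective us); apply/negP; rewrite -leNgt.
  (* Removals in the same round cannot help: even keeping everything together with [C] adds no
     value. *)
  apply: (@le_trans _ _ (f (C |: held alg f s))).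
    by have [_ mono _] := f_objective; apply: mono.
  rewrite /coverage coverU (cover_held rs) (setUidPr _) //.
  apply/subsetP => t /bigcupP[B]; rewrite inE => /eqP ->.
  by case/setIP.
have {hsub} hsub : {subset held alg f (rcons s C) <= held alg f s}.
  move=> B Bh; have /setU1P[BC|//] := subsetP hsub B Bh.
  by rewrite BC (negbTE CH) in Bh.
split=> //.
- move=> B; rewrite mem_rcons inE => /orP[/eqP ->|/(reached_element rs)[B0 Bt]].
    split=> // t /setIP[_]; rewrite inE => /eqP ->; left.
    exact: ltnSn.
  by split=> // t /Bt[tp|[-> _ _]]; left; rewrite ltnS // ltnW.
- by move=> B /hsub /(reached_held rs).
- move=> q; rewrite ltnS leq_eqVlt => /orP[/eqP qp|].
    by exists C; rewrite mem_rcons mem_head qp; split=> //; apply: subsetIr.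
  move=> /(reached_phase rs)[B [Bs Bm Bq]].
  by exists B; rewrite mem_rcons inE Bs orbT.
- move=> q; apply: leq_trans (reached_load rs q); apply: subset_leq_card.
  by apply/setSI/subsetP => t; rewrite !inE => /hsub.
Qed.

Hypothesis phase_gap : forall p, (p < P)%N ->
  alpha * (m%:R * \sum_(p.+1 - n <= q < p.+1) w q)
    < m%:R * \sum_(0 <= q < p) w q + N%:R * w p.

Lemma reached_next p s : (p < P)%N -> reached p 0 s ->
  exists s', reached p.+1 0 s'.
Proof.
move=> pP rs.
(* Either the phase has been completed, or fewer than [m] of its first [i] singletons are held; for
   [i = N] the latter contradicts [phase_gap]. *)
have : forall i, (i <= N)%N -> (exists s', reached p.+1 0 s') \/
    exists s', reached p i s' /\ (#|held_points s' :&: phase p| < m)%N.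
  elim=> [_|i IHi iN].
    right; exists s; split=> //.
    rewrite (_ : _ :&: _ = set0) ?cards0 ?(ltnW m_gt1) //.
    apply/setP => t; rewrite !inE; apply/negbTE/andP => -[th /eqP tp].
    have : t \in held_points s by rewrite inE.
    by move=> /(reached_held_lt rs); rewrite tp ltnn => -[|[]].
  have [|[s' [rs' load]]] := IHi (ltnW iN); first by left.
  have := @reached_send p s' (Ordinal pP, Ordinal iN) erefl rs' load.
  move=> /= {}rs'.
  have [load'|load'] := ltnP #|held_points
    (rcons s' [set (Ordinal pP, Ordinal iN)]) :&: phase p| m.
    by right; exists (rcons s' [set (Ordinal pP, Ordinal iN)]).
  by left; eexists; apply: reached_cover rs' load'.
move=> /(_ N (leqnn _))[//|[s' [rs' _]]].
have := reached_ratio (ltnW pP) rs'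
  (fun t tp => reached_points rs' tp (ltn_ord _)).
have -> : #|phase p| = N.
  have -> : phase p = setX [set Ordinal pP] [set: 'I_N].
    by apply/setP => -[a b]; rewrite !inE andbT.
  by rewrite cardsX cards1 cardsT card_ord mul1n.
by rewrite leNgt phase_gap.
Qed.

Lemma adversary_wins :
  m%:R * \sum_(0 <= q < P) w q
    <= alpha * (m%:R * \sum_(P.+1 - n <= q < P.+1) w q).
Proof.
have : forall p, (p <= P)%N -> exists s, reached p 0 s.
  elim=> [_|p IHp pP]; last first.
    by have [s rs] := IHp (ltnW pP); apply: reached_next rs.
  exists [::]; split=> // [B|q].
    by rewrite held_nil inE.
  rewrite (_ : _ :&: _ = set0) ?cards0 //; apply/setP => t.
  by rewrite !inE held_nil inE.
move=> /(_ P (leqnn P))[s rs].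
have noP t : t.1 = P :> nat -> [set t] \in s.
  by move=> tP; have := ltn_ord t.1; rewrite tP ltnn.
by apply: le_trans (reached_ratio (leqnn P) rs noP); rewrite lerDl mulr_ge0.
Qed.

End Adversary.

(** * Choice of the parameters and conclusion *)

Theorem theorem5p1 (R : realType) (alpha : R)
    (alpha_ge1 : 1 <= alpha) (alpha_gt : expR (alpha - 2) < alpha) :
  exists k : nat, (0 < k)%N /\
    ~ exists alg : algorithm R,
        [/\ free_disposal k alg, strictly_monotone alg
          & competitive_ratio k alg (alpha^-1)].
Proof.
have alpha0 : 0 < alpha by lra.
have [e [gamma [gamma0 gap]]] := weight_gap alpha alpha_ge1 alpha_gt.
pose w q : R := 'C(q + e, e)%:R.
have w_gt0 q : 0 < w q by rewrite ltr0n bin_gt0 leq_addl.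
have w_homo : {homo w : a b / (a <= b)%N >-> a <= b}.
  by move=> a b ab; rewrite ler_nat leq_bin2l // leq_add2r.
(* With [n = e.+1], the past phases sum to [P * w P / n] and the window to at most [n * w P], so the
   ratio would force [P <= alpha * n ^ 2]. *)
pose P := (Num.trunc (alpha * e.+1%:R ^+ 2)).+1.
have P_gt : alpha * e.+1%:R ^+ 2 < P%:R by apply: truncnS_gt.
(* Large enough that [gamma * m] exceeds the [P] places taken from the singletons; the summand [P]
   makes [e.+1 * m - P] an exact subtraction, and [.+2] gives [1 < m]. *)
pose m := (Num.trunc (P%:R / gamma)).+2 + P.
have m_gamma : P%:R < gamma * m%:R.
  rewrite mulrC -ltr_pdivrMr //; apply: lt_le_trans (truncnS_gt _) _.
  by rewrite ler_nat; apply: leqW (leq_addr _ _).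
have kE : (P + (e.+1 * m - P) = e.+1 * m)%N.
  by rewrite subnKC // (leq_trans (leq_addl _ _ : P <= m)%N) // leq_pmull.
exists (e.+1 * m)%N; split=> [|[alg [disposal monotone ratio]]].
  by rewrite muln_gt0.
have m0 : 0 < m%:R :> R by [].
have phase_gap p : (p < P)%N ->
    alpha * (m%:R * \sum_(p.+1 - e.+1 <= q < p.+1) w q)
      < m%:R * \sum_(0 <= q < p) w q + (e.+1 * m - P)%:R * w p.
  move=> _; have := gap p; rewrite -/(w p) -(ler_pM2l m0) => gap_p.
  have : P%:R * w p < gamma * m%:R * w p by rewrite ltr_pM2r.
  have : (e.+1 * m - P)%:R = e.+1%:R * m%:R - P%:R :> R.
    by rewrite natrB ?natrM // -kE leq_addr.
  move=> ->.
  nra.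
have := adversary_wins (fun q => ltW (w_gt0 q)) w_homo _ kE alpha0 disposal
  monotone ratio phase_gap.
move=> /(_ isT).
rewrite mulrCA ler_pM2l // => wins.
have window : \sum_(P.+1 - e.+1 <= q < P.+1) w q <= e.+1%:R * w P.
  apply: (@le_trans _ _ (\sum_(P.+1 - e.+1 <= q < P.+1) w P)).
    rewrite big_seq [leRHS]big_seq; apply: ler_sum => q.
    by rewrite mem_index_iota ltnS => /andP[_ /w_homo].
  rewrite sumr_const_nat -[w P *+ _]mulr_natl ler_wpM2r ?(ltW (w_gt0 P)) //.
  rewrite ler_nat.
  by rewrite leq_subLR addnC -leq_subLR.
have total : e.+1%:R * \sum_(0 <= q < P) w q = P%:R * w P.
  by rewrite -natr_sum sum_bin_diag -!natrM mul_bin_left addnK.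
have := ler_wpM2l (ler0n R e.+1)
  (le_trans wins (ler_wpM2l (ltW alpha0) window)).
have -> : e.+1%:R * (alpha * (e.+1%:R * w P)) = alpha * e.+1%:R ^+ 2 * w P.
  by ring.
by rewrite total ler_pM2r // leNgt P_gt.
Qed.
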